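(* Let $N=\{d_1,\ldots,d_m\}$ be a combinatorial $d$-manifold with $n$ vertices that is the union of $m$ difference cycles $d_i=(a_i^0:\ldots:a_i^d)$, $1\le i\le m$. Fix $l\in\mathbb{N}$ and non-negative integers $l_i^j$ ($1\le i\le m$, $0\le j\le d$) with $\sum_{j=0}^d l_i^j=l$ for each $i$. For $k\ge 0$, let $N_k=\{d_{1,k},\ldots,d_{m,k}\}$ be the simplicial complex on $n+lk$ vertices given by the difference cycles $d_{i,k}=(a_i^0+l_i^0k:\ldots:a_i^d+l_i^dk)$. Suppose that $$\frac{(l_i^j+1)n}{l+1}>a_i^j>\frac{l_i^j n}{l+1}$$ for all $1\le i\le m$ and $0\le j\le d$. Then $N_k$ is a combinatorial $d$-manifold for all $k\ge 0$.
   Context: For positive integers $a_0,\ldots,a_d$ with $N=\sum a_i$, the difference cycle $(a_0:\ldots:a_d)$ on $N$ vertices is the orbit of the simplex $\langle 0,a_0,a_0+a_1,\ldots,\sum_{i=0}^{d-1}a_i\rangle$ under $v\mapsto v+1\bmod N$ on $\mathbb{Z}_N$. A set of difference cycles denotes their union. A combinatorial $d$-manifold is a pure $d$-dimensional simplicial complex in which every vertex link is a triangulated $(d-1)$-sphere PL-homeomorphic to the boundary of the $d$-simplex. *)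

(* Defs.v *)
From HB Require Import structures.
From mathcomp Require Import all_boot all_order all_algebra.
From mathcomp Require Import all_classical reals topology normedtype.

Set Implicit Arguments.
Unset Strict Implicit.
Unset Printing Implicit Defensive.

Import Order.TTheory GRing.Theory Num.Theory.
Import numFieldNormedType.Exports.

Local Open Scope ring_scope.

(** Finite abstract simplicial complexes on vertices in ['I_n] are finite sets
    of faces; the empty face is included, so that the boundary of the
    0-simplex is [[set set0]], the (-1)-sphere. *)

Definition simplicial_complex n (K : {set {set 'I_n}}) : Prop :=
  forall s t : {set 'I_n}, s \in K -> t \subset s -> t \in K.

Definition generated_complex n (F : {set {set 'I_n}}) : {set {set 'I_n}} :=
  [set s : {set 'I_n} | [exists t in F, s \subset t]].

Definition link n (K : {set {set 'I_n}}) (v : 'I_n) : {set {set 'I_n}} :=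
  [set s in K | (v \notin s) && (v |: s \in K)].

Definition simplex_boundary d : {set {set 'I_d.+1}} :=
  [set s : {set 'I_d.+1} | s \proper [set: 'I_d.+1]].

Definition pure_dim n (K : {set {set 'I_n}}) (d : nat) : Prop :=
  (exists2 t, t \in K & #|t| = d.+1) /\
  (forall s, s \in K -> exists t, [/\ t \in K, s \subset t & #|t| = d.+1]).

Section PL.
Variable R : realType.

(** Points of the realization are given by their barycentric coordinates. *)

Definition closed_simplex n (s : {set 'I_n}) : set 'rV[R]_n :=
  [set x | [/\ forall i, 0 <= x ord0 i, \sum_i x ord0 i = 1
             & forall i, i \notin s -> x ord0 i = 0]]%classic.

Definition realization n (K : {set {set 'I_n}}) : set 'rV[R]_n :=
  [set x | exists2 s, s \in K & closed_simplex s x]%classic.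

(** A complex in R^n is an abstract complex [S] together with the positions
    [row i G] of its vertices; [y *m G] is the point of R^n with barycentric
    coordinates [y], so [cell G s] is the convex hull of the rows in [s]. *)

Definition cell p n (G : 'M[R]_(p, n)) (s : {set 'I_p}) : set 'rV[R]_n :=
  [set y *m G | y in closed_simplex s]%classic.

(** Injectivity on [closed_simplex s] says that the vertices of [s] are
    affinely independent. *)
Definition geometric_complex p n (S : {set {set 'I_p}}) (G : 'M[R]_(p, n)) :
    Prop :=
  [/\ simplicial_complex S,
      forall s, s \in S ->
        {in closed_simplex s &, injective (fun y : 'rV[R]_p => y *m G)}
    & forall s t, s \in S -> t \in S ->
        (cell G s `&` cell G t = cell G (s :&: t))%classic].

Definition subdivision n (K : {set {set 'I_n}})
    p (S : {set {set 'I_p}}) (G : 'M[R]_(p, n)) : Prop :=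
  [/\ geometric_complex S G,
      (\bigcup_(s in [set` S]) cell G s = realization K)%classic
    & forall s, s \in S ->
        exists2 t, t \in K & (cell G s `<=` closed_simplex t)%classic].

(** PL maps on |K|: continuous, and affine on each simplex of some
    subdivision of [K]. *)
Definition PL_map n q (K : {set {set 'I_n}}) (f : 'rV[R]_n -> 'rV[R]_q) :
    Prop :=
  {within realization K, continuous f}%classic /\
  exists p (S : {set {set 'I_p}}) (G : 'M[R]_(p, n)),
    subdivision K S G /\
    forall s y, s \in S -> closed_simplex s y ->
      f (y *m G) = \sum_i y ord0 i *: f (row i G).

Definition PL_homeomorphic n q
    (K : {set {set 'I_n}}) (L : {set {set 'I_q}}) : Prop :=
  exists (f : 'rV[R]_n -> 'rV[R]_q) (g : 'rV[R]_q -> 'rV[R]_n),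
    [/\ PL_map K f, PL_map L g,
        (f @` realization K `<=` realization L)%classic,
        (g @` realization L `<=` realization K)%classic
      & {in realization K, cancel f g} /\ {in realization L, cancel g f}].

Definition combinatorial_manifold n (d : nat) (K : {set {set 'I_n}}) : Prop :=
  [/\ simplicial_complex K,
      pure_dim K d
    & forall v : 'I_n, [set v] \in K ->
        PL_homeomorphic (link K v) (simplex_boundary d)].

End PL.

(** [Z_n] is taken to be ['I_n], with [ordS] as the map v |-> v + 1 mod n
    (['Z_n] is not Z/n when n = 1).  [base_simplex] and [difference_cycle] are
    meaningful when the [a i] are positive with sum [n]. *)

Definition base_simplex n d (a : 'I_d.+1 -> nat) : {set 'I_n} :=
  [set v : 'I_n |
    [exists r : 'I_d.+1, nat_of_ord v == (\sum_(i < d.+1 | (i < r)%N) a i)%N]].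

Definition difference_cycle n d (a : 'I_d.+1 -> nat) : {set {set 'I_n}} :=
  [set s in orbit (fun t : {set 'I_n} => @ordS n @: t) (base_simplex n a)].

Definition cycles_complex n d m (a : 'I_m -> 'I_d.+1 -> nat) :
    {set {set 'I_n}} :=
  generated_complex (\bigcup_(i < m) difference_cycle n (a i)).

(* Main.v *)
(** Write p_q, Q_q for the partial sums of (a_j) and (b_j).  The gaps
    x_j = (l+1) a_j - n b_j are positive and sum to n, and their partial sums X_q
    satisfy (l+1) p_q = n Q_q + X_q.  Hence for a facet of N through 0 with
    vertex c = p_q - p_r mod n, the quotient of (l+1) c by n is exactly the number
    of steps of length k that separate the corresponding vertices of N_k.  So
    the strictly increasing map c |-> c + floor((l+1) c / n) k, followed by the
    rotation by v, carries the link of 0 in N onto the link of v in N_k, and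
    PL type is invariant under injective relabelling of the vertices. *)

Require Import Defs.
From HB Require Import structures.
From mathcomp Require Import all_boot all_order all_algebra.
From mathcomp Require Import reals.
From mathcomp Require Import all_classical topology normedtype.
From mathcomp Require Import zify.

Set Implicit Arguments.
Unset Strict Implicit.
Unset Printing Implicit Defensive.

Import Order.TTheory GRing.Theory Num.Theory.
Import numFieldNormedType.Exports.

(** * Partial sums of a difference vector, and iterated rotation *)

(** The same sum as in [base_simplex], but the bound [q] is a natural number, so that [psum a d.+1]
    is the total and the lemmas on partial sums cover it too. *)
Definition psum d (a : 'I_d.+1 -> nat) (q : nat) := \sum_(i < d.+1 | i < q) a i.

Lemma leq_psum d (a : 'I_d.+1 -> nat) q r : q <= r -> psum a q <= psum a r.
Proof.
move=> qr; rewrite /psum big_mkcond [leqRHS]big_mkcond; apply: leq_sum => i _.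
by case: ifP => // /leq_trans->.
Qed.

Lemma psumS d (a : 'I_d.+1 -> nat) (q : 'I_d.+1) :
  psum a q.+1 = a q + psum a q.
Proof.
rewrite /psum (bigD1 q) //=; congr (_ + _); apply: eq_bigl => i.
by rewrite ltnS andbC -ltn_neqAle.
Qed.

Lemma psum_full d (a : 'I_d.+1 -> nat) : psum a d.+1 = \sum_(i < d.+1) a i.
Proof. by apply: eq_bigl => i; rewrite ltn_ord. Qed.

Lemma ltn_psum d (a : 'I_d.+1 -> nat) (q : 'I_d.+1) r :
  (forall i, 0 < a i) -> q < r -> psum a q < psum a r.
Proof.
move=> a_gt0 /(leq_psum a); apply: leq_trans.
by rewrite psumS -addn1 addnC leq_add2r.
Qed.

Lemma ltn_psum_sum d (a : 'I_d.+1 -> nat) (q : 'I_d.+1) :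
  (forall i, 0 < a i) -> psum a q < \sum_(i < d.+1) a i.
Proof. by move=> a_gt0; rewrite -psum_full ltn_psum. Qed.

Lemma psum_inj d (a : 'I_d.+1 -> nat) (q r : 'I_d.+1) :
  (forall i, 0 < a i) -> psum a q = psum a r -> q = r.
Proof.
move=> a_gt0 qr; apply: val_inj; case: (ltngtP q r) => //.
  by move/(ltn_psum a_gt0); rewrite qr ltnn.
by move/(ltn_psum a_gt0); rewrite qr ltnn.
Qed.

Lemma psumD d (a b : 'I_d.+1 -> nat) k q :
  psum (fun j => a j + b j * k) q = psum a q + psum b q * k.
Proof. by rewrite /psum big_split big_distrl. Qed.

Lemma iter_ordS n j (v : 'I_n) : iter j (@ordS n) v = (v + j) %% n :> nat.
Proof.
elim: j => [|j IHj]; first by rewrite addn0 modn_small.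
by rewrite iterS /= IHj -addn1 modnDml addn1 addnS.
Qed.

Lemma iter_ordS_inj n j : injective (iter j (@ordS n)).
Proof. by elim: j => [|j IHj] // x y /ordS_inj /IHj. Qed.

Lemma iter_imset (T : finType) (f : T -> T) j (s : {set T}) :
  iter j (fun t : {set T} => f @: t) s = iter j f @: s.
Proof.
elim: j => [|j IHj]; first by rewrite imset_id.
by rewrite iterS IHj -imset_comp.
Qed.

(** * Faces, purity and vertex links of a union of difference cycles *)

Section CyclesComplex.
Variables (n d m : nat) (a : 'I_m -> 'I_d.+1 -> nat).
Hypothesis a_gt0 : forall i j, 0 < a i j.
Hypothesis a_sum : forall i, \sum_(j < d.+1) a i j = n.

Let psum_lt i (q : 'I_d.+1) : psum (a i) q < n.
Proof. by rewrite -(a_sum i) ltn_psum_sum. Qed.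

Lemma card_base_simplex i : #|base_simplex n (a i)| = d.+1.
Proof.
rewrite (_ : base_simplex _ _ = [set Ordinal (psum_lt i q) | q : 'I_d.+1]).
  rewrite card_imset ?card_ord // => q r [].
  exact: psum_inj.
apply/setP => v; rewrite inE; apply/existsP/imsetP => -[q].
  by move/eqP => vq; exists q => //; apply: val_inj.
by move=> _ ->; exists q.
Qed.

Lemma difference_cycleP (a' : 'I_d.+1 -> nat) (t : {set 'I_n}) :
  reflect (exists w, t = iter w (@ordS n) @: base_simplex n a')
          (t \in difference_cycle n a').
Proof.
rewrite inE -fconnect_orbit; apply: (iffP idP) => [/iter_findex <-|[w ->]].
  by eexists; apply: iter_imset.
by rewrite -iter_imset fconnect_iter.
Qed.

Lemma cycles_complex_facet (s : {set 'I_n}) :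
  s \in cycles_complex n a <->
  exists i w, s \subset iter w (@ordS n) @: base_simplex n (a i).
Proof.
rewrite inE; split=> [/existsP[t /andP[/bigcupP[i _]]]|[i [w sw]]].
  by move=> /difference_cycleP[w ->] sw; exists i, w.
apply/existsP; exists (iter w (@ordS n) @: base_simplex n (a i)).
rewrite sw andbT; apply/bigcupP; exists i => //.
by apply/difference_cycleP; exists w.
Qed.

(** Positivity keeps [psum (a i) q] below [n] for [q <= d], so each partial sum names a vertex of
    the base simplex as it stands, and rotation by [w] becomes addition modulo [n]. *)
Lemma cycles_complexP (s : {set 'I_n}) :
  s \in cycles_complex n a <->
  exists i w, forall x, x \in s ->
    exists q : 'I_d.+1, x = (w + psum (a i) q) %% n :> nat.
Proof.
rewrite cycles_complex_facet; split=> -[i [w sw]]; exists i, w.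
  move=> x /(fintype.subsetP sw) /imsetP[u].
  rewrite inE => /existsP[q /eqP uq] ->.
  by exists q; rewrite iter_ordS uq addnC.
apply/fintype.subsetP => x /sw[q xq]; apply/imsetP.
exists (Ordinal (psum_lt i q)).
  by rewrite inE; apply/existsP; exists q.
by apply: val_inj; rewrite /= iter_ordS addnC.
Qed.

Lemma cycles_complex_simplicial : simplicial_complex (cycles_complex n a).
Proof.
move=> s t /cycles_complexP[i [w sw]] /fintype.subsetP ts.
apply/cycles_complexP.
by exists i, w => x /ts /sw.
Qed.

(** The argument in ['I_m] supplies the facet that [pure_dim] asks for; an empty union has none. *)
Lemma cycles_complex_pure : 'I_m -> pure_dim (cycles_complex n a) d.
Proof.
pose F i w := iter w (@ordS n) @: base_simplex n (a i).
have FK i w : F i w \in cycles_complex n a.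
  by apply/cycles_complex_facet; exists i, w.
have cardF i w : #|F i w| = d.+1.
  by rewrite card_imset ?card_base_simplex //; apply: iter_ordS_inj.
move=> i; split; first by exists (F i 0).
by move=> s /cycles_complex_facet[j [w sw]]; exists (F j w).
Qed.

(** Here [r] is the place that [v] occupies in a facet containing [v |: s], which forces the
    rotation to be [v - psum (a i) r]. Writing [n - psum (a i) r] avoids truncated subtraction. *)
Lemma cycles_linkP v (s : {set 'I_n}) :
  s \in link (cycles_complex n a) v <->
  v \notin s /\ exists i (r : 'I_d.+1), forall x, x \in s ->
    exists q : 'I_d.+1,
      x = (v + (psum (a i) q + (n - psum (a i) r))) %% n :> nat.
Proof.
rewrite inE; split=> [/and3P[_ vNs /cycles_complexP[i [w sw]]]|].
  split=> //; have [r vr] := sw v (setU11 _ _); exists i, r => x xs.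
  have [q xq] := sw x (setU1r _ xs); exists q; rewrite xq vr modnDml.
  rewrite -[LHS]modnDr; congr (_ %% n).
  by have := psum_lt i r; lia.
move=> [vNs [i [r sr]]].
suff vsK : v |: s \in cycles_complex n a.
  by rewrite vNs vsK (cycles_complex_simplicial vsK (finset.subsetUr _ _)).
(* This rotation puts the vertex at place [r] onto [v]. *)
apply/cycles_complexP; exists i, (v + (n - psum (a i) r)) => x.
rewrite in_setU1 => /predU1P[->|/sr[q xq]].
  exists r; rewrite -addnA subnK; last exact/ltnW.
  by rewrite modnDr modn_small.
by exists q; rewrite xq -addnA [in RHS](addnC (n - _)).
Qed.

End CyclesComplex.

(** * The vertex map from [N] to [N_k] *)

Section Stretch.
Variables (n l k : nat).

(** Since [c < n], the quotient is at most [l], so no reduction modulo [n + l * k] is needed before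
    rotating. *)
Lemma stretch_subproof (c : 'I_n) : c + (c * l.+1 %/ n) * k < n + l * k.
Proof.
have n_gt0 : 0 < n by apply: leq_ltn_trans (ltn_ord c).
have : c * l.+1 %/ n <= l by rewrite -ltnS ltn_divLR // mulnC ltn_pmul2l.
move=> /leq_mul/(_ (leqnn k)); have := ltn_ord c; lia.
Qed.

(** The quotient counts the positive multiples of n/(l+1) that are at most [c]: a block of [k] new
    vertices is inserted at each of the [l] such multiples below [n]. *)
Definition stretch (v : nat) (c : 'I_n) : 'I_(n + l * k) :=
  iter v (@ordS _) (Ordinal (stretch_subproof c)).

Lemma stretchE v c :
  stretch v c = (v + (c + (c * l.+1 %/ n) * k)) %% (n + l * k) :> nat.
Proof. by rewrite /stretch iter_ordS addnC. Qed.

Lemma stretch_inj v : injective (stretch v).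
Proof.
move=> x y /iter_ordS_inj [] xy; apply: val_inj => /=.
(* Once [x <= y], the quotients are ordered the same way, so equal images leave no room for
   [x < y]. *)
wlog lexy : x y xy / x <= y => [W|].
  by case/orP: (leq_total x y) => [|yx]; [apply: W | symmetry; apply: W].
have : x * l.+1 %/ n <= y * l.+1 %/ n.
  by rewrite leq_div2r ?leq_mul2r ?lexy ?orbT.
nia.
Qed.

Variables (d : nat) (a b : 'I_d.+1 -> nat).
Hypothesis a_gt0 : forall j, 0 < a j.
Hypothesis a_sum : \sum_(j < d.+1) a j = n.
Hypothesis b_sum : \sum_(j < d.+1) b j = l.
Hypothesis b_lt : forall j, b j * n < a j * l.+1.

Let a' j := a j + b j * k.

(** Division of (l+1) c by n is read off from [axb]: the differences of the [psum b] give the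
    quotient, those of the [psum x] the remainder. The cases [r <= q] and [q < r] differ by one turn
    around the cycle. *)
Lemma stretch_gap (q r : 'I_d.+1) :
  let c := (psum a q + (n - psum a r)) %% n in
  c + (c * l.+1 %/ n) * k =
  (psum a' q + (n + l * k - psum a' r)) %% (n + l * k).
Proof.
move=> c; rewrite {}/c.
pose x j := a j * l.+1 - b j * n.
have x_gt0 j : 0 < x j by rewrite subn_gt0.
have axb i : psum a i * l.+1 = psum b i * n + psum x i.
  rewrite /psum !big_distrl -big_split; apply: eq_bigr => j _ /=.
  by rewrite subnKC // ltnW.
have x_sum : \sum_(j < d.+1) x j = n.
  by have := axb d.+1; rewrite !psum_full a_sum b_sum; nia.
have a'_gt0 j : 0 < a' j by rewrite addn_gt0 a_gt0.
have a'_sum : \sum_(j < d.+1) a' j = n + l * k.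
  by rewrite -psum_full psumD !psum_full a_sum b_sum.
have xq := ltn_psum_sum q x_gt0; have xr := ltn_psum_sum r x_gt0.
rewrite x_sum in xq xr.
have aq := ltn_psum_sum q a_gt0; have ar := ltn_psum_sum r a_gt0.
rewrite a_sum in aq ar.
have n_gt0 := leq_ltn_trans (leq0n _) aq.
have a'q := ltn_psum_sum q a'_gt0; have a'r := ltn_psum_sum r a'_gt0.
rewrite a'_sum in a'q a'r.
have axq := axb q; have axr := axb r.
have [rq|qr] := leqP r q.
  have -> : (psum a q + (n - psum a r)) %% n = psum a q - psum a r.
    have := leq_psum a rq => le_a.
    rewrite (_ : _ + _ = psum a q - psum a r + n); last by lia.
    by rewrite modnDr modn_small //; lia.
  have -> : (psum a' q + (n + l * k - psum a' r)) %% (n + l * k) =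
      psum a' q - psum a' r.
    have := leq_psum a' rq => le_a'.
    rewrite (_ : _ + _ = psum a' q - psum a' r + (n + l * k)); last by lia.
    by rewrite modnDr modn_small //; lia.
  (* The last term lies in [0, n), because the partial sums of [x] are monotone and below [n]. *)
  have -> : (psum a q - psum a r) * l.+1 =
      (psum b q - psum b r) * n + (psum x q - psum x r).
    have := leq_psum b rq; have := leq_psum x rq.
    by rewrite !mulnBl axq axr; nia.
  rewrite divnMDl // divn_small ?addn0; last by lia.
  rewrite !psumD mulnBl; have := leq_psum a rq.
  by have := leq_mul (leq_psum b rq) (leqnn k); lia.
have lt_a := ltn_psum a_gt0 qr; have lt_a' := ltn_psum a'_gt0 qr.
have lt_x := ltn_psum x_gt0 qr; have le_b := leq_psum b (ltnW qr).
have br : psum b r <= l by rewrite -b_sum -psum_full; apply/leq_psum/ltnW.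
rewrite !modn_small; [|lia..].
(* The full turn contributes (l+1) n, split as l n for the quotient and n for the remainder. The
   remainder stays below [n] because [psum x q < psum x r] strictly. *)
have -> : (psum a q + (n - psum a r)) * l.+1 =
    (psum b q + (l - psum b r)) * n + (n - (psum x r - psum x q)).
  by rewrite !mulnDl !mulnBl axq axr; nia.
rewrite divnMDl // divn_small ?addn0; last by lia.
rewrite !psumD mulnDl mulnBl.
by have := leq_mul br (leqnn k); rewrite -/(psum _ _); nia.
Qed.

End Stretch.

Local Open Scope ring_scope.

(** * Invariance of PL type under injective relabelling of vertices *)

Section Relabelling.
Variable R : realType.

Lemma mulmxr_continuous n p (A : 'M[R]_(n, p)) :
  continuous (fun x : 'rV[R]_n => x *m A).
Proof.
rewrite (_ : (fun x => _) = fun x : 'rV_n => \sum_i x ord0 i *: row i A).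
  apply: continuous_big => [|i _ x]; first exact: add_continuous.
  by apply: cvgZr_tmp; [apply: nbhs_filter | apply: coord_continuous].
by apply/funext => x; rewrite mulmx_sum_row.
Qed.

(** Used to pull a map that is continuous only within [realization K] back along the linear map
    given by [E^T]. *)
Lemma within_continuous_comp_in (T U V : topologicalType) (A : set T)
    (B : set U) (f : T -> U) (g : U -> V) :
  continuous f -> (f @` A `<=` B)%classic ->
  {within B, continuous g}%classic -> {within A, continuous (g \o f)}%classic.
Proof.
move=> cf fAB /subspace_continuousP cg; apply/subspace_continuousP => x Ax.
have Bfx : B (f x) by apply: fAB; exists x.
move=> W Wgfx; have /cf := cg _ Bfx W Wgfx.
rewrite /nbhs /= => nBW.
rewrite /within /=; near=> y => Ay; have : B (f y) by apply: fAB; exists y.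
by near: y.
Unshelve. all: by end_near.
Qed.

Variables (n n' : nat) (phi : 'I_n -> 'I_n').
Hypothesis phi_inj : injective phi.

(** The linear extension of [phi] to barycentric coordinates. Its transpose is a left inverse, and a
    two-sided one on points supported on [codom phi]. *)
Definition relabel_mx : 'M[R]_(n, n') := \matrix_(i, j) (phi i == j)%:R.
Let E := relabel_mx.

Definition relabel (K : {set {set 'I_n}}) : {set {set 'I_n'}} :=
  [set phi @: (s : {set 'I_n}) | s in K].

Lemma relabel_mxE (x : 'rV[R]_n) i : (x *m E) ord0 (phi i) = x ord0 i.
Proof.
rewrite mxE (bigD1 i) //= !mxE eqxx mulr1 big1 ?addr0 // => j ji.
by rewrite !mxE (inj_eq phi_inj) (negPf ji) mulr0.
Qed.

Lemma relabel_mx_notin (x : 'rV[R]_n) j :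
  j \notin codom phi -> (x *m E) ord0 j = 0.
Proof.
move=> jN; rewrite mxE big1 // => i _; rewrite !mxE.
by case: eqP => [ij|]; [rewrite -ij codom_f in jN | rewrite mulr0].
Qed.

Lemma relabel_mx_trE (z : 'rV[R]_n') i : (z *m E^T) ord0 i = z ord0 (phi i).
Proof.
rewrite mxE (bigD1 (phi i)) //= !mxE eqxx mulr1 big1 ?addr0 // => j ji.
by rewrite !mxE eq_sym (negPf ji) mulr0.
Qed.

Lemma relabel_mxK m (A : 'M[R]_(m, n)) : A *m E *m E^T = A.
Proof.
apply/row_matrixP => i; rewrite !row_mul; apply/rowP => j.
by rewrite relabel_mx_trE relabel_mxE.
Qed.

Lemma sum_relabel (z : 'rV[R]_n') :
  (forall j, j \notin codom phi -> z ord0 j = 0) ->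
  \sum_i z ord0 (phi i) = \sum_j z ord0 j.
Proof.
move=> z0; rewrite [RHS](bigID (mem (codom phi))) /= [X in _ + X]big1 //.
rewrite addr0 (eq_bigl (mem (phi @: 'I_n))) => [|j /=].
  by rewrite big_imset //= => i j _ _; apply: phi_inj.
by apply/codomP/imsetP => -[i]; [exists i | move=> _ ->; exists i].
Qed.

Lemma closed_simplex_relabel (s : {set 'I_n}) (x : 'rV[R]_n) :
  closed_simplex s x -> closed_simplex (phi @: s) (x *m E).
Proof.
move=> [x0 x1 xs]; split=> [j||j jN].
- have [/codomP[i ->]|jN] := boolP (j \in codom phi).
    by rewrite relabel_mxE.
  by rewrite relabel_mx_notin.
- rewrite -sum_relabel; last exact: relabel_mx_notin.
  by under eq_bigr do rewrite relabel_mxE.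
- have [/codomP[i ji]|jN'] := boolP (j \in codom phi).
    rewrite ji relabel_mxE xs //; apply: contra jN => iN.
    by rewrite ji imset_f.
  exact: relabel_mx_notin.
Qed.

Lemma closed_simplex_relabel_tr (s : {set 'I_n}) (z : 'rV[R]_n') :
  closed_simplex (phi @: s) z ->
  closed_simplex s (z *m E^T) /\ z *m E^T *m E = z.
Proof.
move=> [z0 z1 zs].
have zN j : j \notin codom phi -> z ord0 j = 0.
  move=> jN; apply: zs; apply: contra jN => /imsetP[i _ ->].
  exact: codom_f.
split; last first.
  apply/rowP => j; have [/codomP[i ->]|jN] := boolP (j \in codom phi).
    by rewrite relabel_mxE relabel_mx_trE.
  by rewrite relabel_mx_notin // zN.
split=> [i||i iN]; rewrite ?relabel_mx_trE //.
- by under eq_bigr do rewrite relabel_mx_trE; rewrite sum_relabel.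
- by apply: zs; rewrite (mem_imset _ _ phi_inj).
Qed.

Lemma realization_relabel (K : {set {set 'I_n}}) (x : 'rV[R]_n) :
  realization K x -> realization (relabel K) (x *m E).
Proof.
move=> [s sK xs]; exists (phi @: s); first exact: imset_f.
exact: closed_simplex_relabel.
Qed.

Lemma realization_relabel_tr (K : {set {set 'I_n}}) (z : 'rV[R]_n') :
  realization (relabel K) z ->
  realization K (z *m E^T) /\ z *m E^T *m E = z.
Proof.
move=> [_ /imsetP[s sK ->] /closed_simplex_relabel_tr[zs zE]].
by split=> //; exists s.
Qed.

Lemma cell_relabel p (G : 'M[R]_(p, n)) (s : {set 'I_p}) (z : 'rV[R]_n') :
  cell (G *m E) s z <-> exists2 x, cell G s x & x *m E = z.
Proof.
split=> [[y ys <-]|[_ [y ys <-] <-]].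
  by exists (y *m G); [exists y | rewrite mulmxA].
by exists y; rewrite // mulmxA.
Qed.

(** The abstract complex [S] is kept and only the vertex positions are moved by [E]; injectivity of
    [E] preserves affine independence and intersections of cells. *)
Lemma subdivision_relabel (K : {set {set 'I_n}}) p (S : {set {set 'I_p}})
    (G : 'M[R]_(p, n)) :
  subdivision K S G -> subdivision (relabel K) S (G *m E).
Proof.
move=> [[Ssc Ginj Gcap] Gcup Gsub]; split; first split=> //.
- move=> s sS y y' ys y's; rewrite !mulmxA => yy'; apply: Ginj ys y's _ => //.
  by rewrite -[LHS]relabel_mxK yy' relabel_mxK.
- move=> s t sS tS; apply/seteqP; split=> z /=.
    move=> [/cell_relabel[x xs xz] /cell_relabel[x' x't x'z]].
    have xx' : x' = x by rewrite -[LHS]relabel_mxK x'z -xz relabel_mxK.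
    apply/cell_relabel; exists x => //; rewrite -Gcap //; split=> //.
    by rewrite -xx'.
  move=> /cell_relabel[x]; rewrite -Gcap // => -[xs xt] <-.
  by split; apply/cell_relabel; exists x.
- apply/seteqP; split=> z.
    move=> [s sS /cell_relabel[x xs <-]]; apply: realization_relabel.
    by rewrite -Gcup; exists s.
  move=> /realization_relabel_tr[]; rewrite -Gcup => -[s sS zs] zE.
  by exists s => //; apply/cell_relabel; exists (z *m E^T).
- move=> s /Gsub[t tK st]; exists (phi @: t); first exact: imset_f.
  move=> _ /cell_relabel[x /st xt <-].
  exact: closed_simplex_relabel.
Qed.

(** The homeomorphisms are composed with [E^T] and [E]. Linearity keeps them affine on cells: on the
    side of [K] the subdivision is carried along by [E], on the side of [L] it is unchanged. *)
Lemma PL_homeomorphic_relabel (K : {set {set 'I_n}}) q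
    (L : {set {set 'I_q}}) :
  PL_homeomorphic R K L -> PL_homeomorphic R (relabel K) L.
Proof.
move=> [f [g [[fc [p [S [G [SG fG]]]]] [gc [p' [S' [G' [SG' gG']]]]] fKL gLK]]].
move=> [fK gK]; exists (fun z => f (z *m E^T)), (fun x => g x *m E); split.
- split.
    apply: (within_continuous_comp_in (@mulmxr_continuous _ _ E^T) _ fc).
    by move=> _ [z /realization_relabel_tr[zK _] <-].
  exists p, S, (G *m E); split; first exact: subdivision_relabel.
  move=> s y sS ys; rewrite mulmxA relabel_mxK (fG s) //.
  by apply: eq_bigr => i _; rewrite row_mul relabel_mxK.
- split.
    apply: (@within_continuous_comp _ _ _ _ g (mulmx^~ E) _ gc) => z _.
    exact: mulmxr_continuous.
  exists p', S', G'; split=> // s y sS ys.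
  rewrite (gG' s) // mulmx_suml.
  by apply: eq_bigr => i _; rewrite scalemxAl.
- move=> _ [z /realization_relabel_tr[zK _] <-]; apply: fKL.
  by exists (z *m E^T).
- move=> _ [x xL <-]; apply: realization_relabel; apply: gLK.
  by exists x.
- split=> [z|x xL].
    rewrite inE => /realization_relabel_tr[zK zE].
    by rewrite fK ?inE.
  by rewrite relabel_mxK gK.
Qed.

End Relabelling.

Theorem theorem3p7 (R : realType) (d m n l : nat)
    (a b : 'I_m -> 'I_d.+1 -> nat)
    (a_gt0 : forall i j, (0 < a i j)%N)
    (a_sum : forall i, (\sum_(j < d.+1) a i j)%N = n)
    (N_manifold : combinatorial_manifold R d (cycles_complex n a))
    (b_sum : forall i, (\sum_(j < d.+1) b i j)%N = l)
    (ab_bounds : forall i j,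
       ((b i j + 1) * n)%N%:R / (l + 1)%N%:R > (a i j)%:R :> rat /\
       (a i j)%:R > (b i j * n)%N%:R / (l + 1)%N%:R :> rat)
    (k : nat) :
  combinatorial_manifold R d
    (cycles_complex (n + l * k) (fun i j => (a i j + b i j * k)%N)).
Proof.
have b_lt i j : (b i j * n < a i j * l.+1)%N.
  have [_] := ab_bounds i j.
  by rewrite addn1 ltr_pdivrMr ?ltr0n // -natrM ltr_nat.
(* Purity provides a face, hence an index [i0], so there is at least one cycle and [n] is
   positive. *)
case: N_manifold => _ [[t tK _] _] N_link.
have [i0 _] := (cycles_complexP a_gt0 a_sum t).1 tK.
have n_gt0 : (0 < n)%N.
  rewrite -(a_sum i0).
  exact: leq_ltn_trans (leq0n _) (ltn_psum_sum ord0 (a_gt0 i0)).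
pose o : 'I_n := Ordinal n_gt0.
have oK : [set o] \in cycles_complex n a.
  apply/(cycles_complexP a_gt0 a_sum); exists i0, 0%N => x /set1P->.
  by exists ord0; rewrite /psum big_pred0_eq mod0n.
pose a' i j := (a i j + b i j * k)%N.
have a'_gt0 i j : (0 < a' i j)%N by rewrite addn_gt0 a_gt0.
have a'_sum i : (\sum_(j < d.+1) a' i j)%N = (n + l * k)%N.
  by rewrite -psum_full psumD !psum_full a_sum b_sum.
split.
- exact: cycles_complex_simplicial.
- exact: cycles_complex_pure.
move=> v _.
suff -> : link (cycles_complex (n + l * k) a') v =
    relabel (@stretch n l k v) (link (cycles_complex n a) o).
  by apply: PL_homeomorphic_relabel (N_link o oK); apply: stretch_inj.
(* Vertex 0 goes to [v], so by injectivity a set avoids 0 exactly when its image avoids [v]. *)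
have stretch_o : stretch l k v o = v.
  by apply: val_inj; rewrite /= stretchE mul0n div0n !addn0 modn_small.
(* The vertex at place [q] of the [i]-th facet, rotated so that place [r] sits at 0. *)
pose c i (q r : 'I_d.+1) : 'I_n :=
  Ordinal (ltn_pmod (psum (a i) q + (n - psum (a i) r)) n_gt0).
have stretch_c i (q r : 'I_d.+1) : stretch l k v (c i q r) =
    ((v + (psum (a' i) q + (n + l * k - psum (a' i) r))) %% (n + l * k))%N :> nat.
  by rewrite stretchE (stretch_gap k (a_gt0 i) (a_sum i) (b_sum i)) // modnDmr.
apply/setP => s'; apply/idP/imsetP.
  move=> /(cycles_linkP a'_gt0 a'_sum)[vNs' [i [r s'r]]].
  (* Every vertex of [s'] lies in the image of [stretch], so [s'] is the image of its own preimage,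
     which serves as the face of the link of 0. *)
  have s'c x : x \in s' -> exists q, x = stretch l k v (c i q r).
    by move=> /s'r[q xq]; exists q; apply: val_inj; rewrite /= stretch_c.
  exists (stretch l k v @^-1: s').
    apply/(cycles_linkP a_gt0 a_sum); rewrite inE stretch_o; split=> //.
    exists i, r => x; rewrite inE => /s'c[q /stretch_inj ->].
    by exists q; rewrite add0n.
  apply/setP => x; apply/idP/imsetP => [xs'|[y]]; last by rewrite inE => ? ->.
  by have [q xq] := s'c x xs'; exists (c i q r); rewrite ?inE -?xq.
move=> [s /(cycles_linkP a_gt0 a_sum)[oNs [i [r sr]]] ->].
apply/(cycles_linkP a'_gt0 a'_sum); split.
  by rewrite -[v in v \notin _]stretch_o (mem_imset _ _ (@stretch_inj n l k v)).
exists i, r => _ /imsetP[x xs ->]; have [q xq] := sr x xs; exists q.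
by rewrite -stretch_c; congr (val (stretch l k v _)); apply: val_inj.
Qed.
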